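(* Let $\alpha, A, B$ be real constants with $\alpha\neq 0$, $B\ne 0$, and $\left|\frac{A}{\alpha}\right|<1$. Then for every (well-defined) solution $(x_n)_{n=-3}^\infty$ of $$x_{n+1}=\frac{\alpha x_{n-3}}{A+B x_{n-1}x_{n-3}},\qquad n\ge 0,$$ with nonzero real initial data $x_{-3}=d$, $x_{-2}=c$, $x_{-1}=b$, $x_0=a$, the subsequences $(x_{4n-3})_n$, $(x_{4n-2})_n$, $(x_{4n-1})_n$ and $(x_{4n})_n$ converge as $n\to\infty$.
   Context: A solution is a real sequence $(x_n)_{n\ge -3}$ with the given initial data satisfying the recurrence for all $n\ge 0$; it is understood to be well defined, i.e. the denominator $A+Bx_{n-1}x_{n-3}$ is nonzero for every $n\ge 0$. Convergence means convergence to a finite real limit. *)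

(* Defs.v *)
From Stdlib Require Import Reals ZArith.
From Coquelicot Require Import Coquelicot.
Open Scope R_scope.

(* A sequence (x_n)_{n >= -3} is represented by x : Z -> R; the values x n for
   n < -3 are unconstrained and never used.  Division is total on R, so the
   nonvanishing of the denominators is required explicitly. *)
Definition well_defined (A B : R) (x : Z -> R) : Prop :=
  forall n : Z, (0 <= n)%Z -> A + B * x (n - 1)%Z * x (n - 3)%Z <> 0.

Definition satisfies_recurrence (alpha A B : R) (x : Z -> R) : Prop :=
  forall n : Z, (0 <= n)%Z ->
    x (n + 1)%Z = alpha * x (n - 3)%Z / (A + B * x (n - 1)%Z * x (n - 3)%Z).

Definition is_solution (alpha A B a b c d : R) (x : Z -> R) : Prop :=
  (x (-3)%Z = d /\ x (-2)%Z = c /\ x (-1)%Z = b /\ x 0%Z = a) /\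
  well_defined A B x /\
  satisfies_recurrence alpha A B x.

(* Main.v *)
(** Along indices of fixed parity, [w = 1 / (x_{n-1} x_{n-3})] satisfies the
    affine recurrence [w' = (A / alpha) w + B / alpha], so it converges
    geometrically to a nonzero limit.  Since [x_{n+1} / x_{n-3} = w / w'], each
    subsequence of step 4 is an infinite product whose factors tend to 1
    geometrically fast, hence converges. *)
Require Import Defs.
From Stdlib Require Import Reals ZArith Lra Lia.
From Coquelicot Require Import Coquelicot.
Open Scope R_scope.

(** Telescoping: the partial sum of the increments up to index [n] is [y (S n) - y 0]. *)
Lemma ex_finite_lim_seq_of_increments (y : nat -> R) :
  ex_series (fun n => y (S n) - y n) -> ex_finite_lim_seq y.
Proof.
  intros [l Hl]; exists (y 0%nat + l).
  apply is_lim_seq_incr_1.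
  apply is_lim_seq_ext with
    (fun n => y 0%nat + sum_n (fun k => y (S k) - y k) n).
  - induction n as [|n IH].
    + rewrite sum_O; lra.
    + rewrite sum_Sn; unfold plus; simpl; lra.
  - apply is_lim_seq_plus'; [apply is_lim_seq_const | exact Hl].
Qed.

Lemma ex_finite_lim_seq_bounded (u : nat -> R) :
  ex_finite_lim_seq u -> exists M, forall n, Rabs (u n) <= M.
Proof.
  intros Hu.
  destruct (@filterlim_bounded R_AbsRing R_NormedModule u Hu) as [M HM].
  exists M; exact HM.
Qed.

(** Since [1 + t <= exp t], each factor costs at most [exp (Rabs (e n))], so the product is
    controlled by the exponential of a convergent sum. *)
Lemma bounded_product (y e : nat -> R) :
  (forall n, y (S n) = y n * (1 + e n)) ->
  ex_series (fun n => Rabs (e n)) ->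
  exists M, forall n, Rabs (y n) <= M.
Proof.
  intros Hy He.
  assert (Hsum : forall n,
    Rabs (y (S n)) <= Rabs (y 0%nat) * exp (sum_n (fun k => Rabs (e k)) n)).
  (* The exponent [t] is left free so that one step serves both the base case ([t = 0]) and the
     induction ([t] a partial sum). *)
  { assert (Hstep : forall n t, Rabs (y n) <= Rabs (y 0%nat) * exp t ->
      Rabs (y (S n)) <= Rabs (y 0%nat) * exp (t + Rabs (e n))).
    { intros n t H; rewrite Hy, Rabs_mult, exp_plus, <- Rmult_assoc.
      apply Rmult_le_compat; auto using Rabs_pos.
      apply Rle_trans with (1 + Rabs (e n)).
      - eapply Rle_trans; [apply Rabs_triang|]; rewrite Rabs_R1; lra.
      - apply exp_ineq1_le. }
    induction n as [|n IH].
    - rewrite sum_O; replace (Rabs (e 0%nat)) with (0 + Rabs (e 0%nat)) by ring.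
      apply Hstep; rewrite exp_0; lra.
    - rewrite sum_Sn; apply Hstep, IH. }
  destruct (ex_finite_lim_seq_bounded
              (fun n => Rabs (y 0%nat) * exp (sum_n (fun k => Rabs (e k)) n)))
    as [M HM].
  - destruct He as [l Hl].
    exists (Rabs (y 0%nat) * exp l).
    apply (is_lim_seq_scal_l _ _ (exp l)).
    apply is_lim_seq_continuous; [|exact Hl].
    apply derivable_continuous_pt, derivable_pt_exp.
  (* [Hsum] bounds only the terms [y (S n)]; the maximum takes care of [y 0]. *)
  - exists (Rmax (Rabs (y 0%nat)) M); intros [|n].
    + apply Rmax_l.
    + eapply Rle_trans; [apply Hsum|].
      eapply Rle_trans; [apply Rle_abs|].
      eapply Rle_trans; [apply HM | apply Rmax_r].
Qed.

(** Boundedness of [y] makes the increments [y n * e n] absolutely summable. This avoids logarithms,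
    so factors may be negative or zero. *)
Lemma ex_finite_lim_product (y e : nat -> R) :
  (forall n, y (S n) = y n * (1 + e n)) ->
  ex_series (fun n => Rabs (e n)) ->
  ex_finite_lim_seq y.
Proof.
  intros Hy He.
  destruct (bounded_product y e Hy He) as [M HM].
  apply ex_finite_lim_seq_of_increments.
  apply (@ex_series_le R_AbsRing R_CompleteNormedModule _ (fun n => M * Rabs (e n))).
  - intros n; change (Rabs (y (S n) - y n) <= M * Rabs (e n)).
    rewrite Hy; replace (y n * (1 + e n) - y n) with (y n * e n) by ring.
    rewrite Rabs_mult; apply Rmult_le_compat_r; [apply Rabs_pos | apply HM].
  - apply (ex_series_scal_l M (fun n => Rabs (e n)) He).
Qed.

Section AffineRecurrence.

Variables (q beta : R) (w : nat -> R).
Hypothesis (Hq : Rabs q < 1) (Hbeta : beta <> 0).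
Hypothesis Hw : forall k, w (S k) = q * w k + beta.
Hypothesis Hw0 : forall k, w k <> 0.

(** [w] tends to the fixed point [beta / (1 - q)] of the affine map, which is nonzero because [beta]
    is; hence the inverses converge too. *)
Lemma affine_inv_bounded : exists M, forall k, Rabs (/ w k) <= M.
Proof.
  assert (H1 : 1 - q <> 0) by (apply Rabs_def2 in Hq; lra).
  apply ex_finite_lim_seq_bounded.
  exists (/ (beta / (1 - q))).
  apply (is_lim_seq_inv w (beta / (1 - q))).
  - apply is_lim_seq_ext with
      (fun k => q ^ k * (w 0%nat - beta / (1 - q)) + beta / (1 - q)).
    + induction n as [|n IH]; simpl; [ring|].
      rewrite Hw, <- IH; field; exact H1.
    + replace (Finite (beta / (1 - q))) with
        (Finite (0 * (w 0%nat - beta / (1 - q)) + beta / (1 - q)))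
        by (f_equal; ring).
      apply is_lim_seq_plus'; [|apply is_lim_seq_const].
      apply is_lim_seq_mult'; [|apply is_lim_seq_const].
      apply is_lim_seq_geom, Hq.
  - intros H; injection H; intros H2.
    apply Hbeta; replace beta with (beta / (1 - q) * (1 - q)) by (field; exact H1).
    rewrite H2; ring.
Qed.

Lemma affine_increment (k : nat) : w k - w (S k) = q ^ k * (w 0%nat - w 1%nat).
Proof.
  induction k as [|k IH]; simpl; [ring|].
  replace (w (S k) - w (S (S k))) with (q * (w k - w (S k)))
    by (rewrite (Hw (S k)), (Hw k); ring).
  rewrite IH; ring.
Qed.

(** Each term is [(w (2 * m) - w (S (2 * m))) / w (S (2 * m))] in absolute value: the numerator is
    of order [q ^ (2 * m)] and the inverse of the denominator is bounded. Only even indices matter,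
    as one step of length 4 in [x] is two steps in [w]. *)
Lemma affine_quotients_summable :
  ex_series (fun m => Rabs (w (2 * m)%nat / w (S (2 * m)) - 1)).
Proof.
  destruct affine_inv_bounded as [M HM].
  apply (@ex_series_le R_AbsRing R_CompleteNormedModule _
           (fun m => (Rabs (w 0%nat - w 1%nat) * M) * (q ^ 2) ^ m)).
  - intros m.
    change (Rabs (Rabs (w (2 * m)%nat / w (S (2 * m)) - 1))
            <= (Rabs (w 0%nat - w 1%nat) * M) * (q ^ 2) ^ m).
    rewrite Rabs_Rabsolu.
    replace (w (2 * m)%nat / w (S (2 * m)) - 1)
      with ((w (2 * m)%nat - w (S (2 * m))) * / w (S (2 * m)))
      by (field; apply Hw0).
    rewrite affine_increment, !Rabs_mult, pow_mult.
    rewrite (Rabs_pos_eq ((q ^ 2) ^ m)) by (apply pow_le, pow2_ge_0).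
    rewrite (Rmult_comm ((q ^ 2) ^ m)), !Rmult_assoc.
    apply Rmult_le_compat_l; [apply Rabs_pos|].
    rewrite Rmult_comm.
    apply Rmult_le_compat_r; [apply pow_le, pow2_ge_0 | apply HM].
  - apply (ex_series_scal_l (Rabs (w 0%nat - w 1%nat) * M) (fun m => (q ^ 2) ^ m)).
    apply ex_series_geom.
    rewrite <- RPow_abs.
    pose proof (Rabs_pos q); nra.
Qed.

End AffineRecurrence.

(** The induction carries a window of four consecutive terms, because the new term is a nonzero
    multiple of the oldest one. *)
Lemma solution_neq_0 (alpha A B a b c d : R) (x : Z -> R) :
  alpha <> 0 -> a <> 0 -> b <> 0 -> c <> 0 -> d <> 0 ->
  is_solution alpha A B a b c d x ->
  forall n : Z, (-3 <= n)%Z -> x n <> 0.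
Proof.
  intros Halpha Ha Hb Hc Hd [[Hx3 [Hx2 [Hx1 Hx0]]] [Hwd Hrec]].
  assert (H : forall k : nat,
    x (Z.of_nat k - 3)%Z <> 0 /\ x (Z.of_nat k - 2)%Z <> 0 /\
    x (Z.of_nat k - 1)%Z <> 0 /\ x (Z.of_nat k) <> 0).
  { induction k as [|k [H3 [H2 [H1 H0]]]].
    - simpl; rewrite Hx3, Hx2, Hx1, Hx0; auto.
    - rewrite Nat2Z.inj_succ; unfold Z.succ.
      replace (Z.of_nat k + 1 - 3)%Z with (Z.of_nat k - 2)%Z by ring.
      replace (Z.of_nat k + 1 - 2)%Z with (Z.of_nat k - 1)%Z by ring.
      replace (Z.of_nat k + 1 - 1)%Z with (Z.of_nat k) by ring.
      repeat split; auto.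
      rewrite Hrec by lia.
      apply Rmult_integral_contrapositive_currified.
      + apply Rmult_integral_contrapositive_currified; auto.
      + apply Rinv_neq_0_compat, Hwd; lia. }
  intros n Hn.
  destruct (H (Z.to_nat (n + 3))) as [Hn3 _].
  rewrite Z2Nat.id in Hn3 by lia.
  replace (n + 3 - 3)%Z with n in Hn3 by ring; exact Hn3.
Qed.

Lemma step_4_subsequence_converges (alpha A B : R) (x : Z -> R) (i : Z) :
  alpha <> 0 -> B <> 0 -> Rabs (A / alpha) < 1 -> (-3 <= i)%Z ->
  (forall n : Z, (-3 <= n)%Z -> x n <> 0) ->
  well_defined A B x -> satisfies_recurrence alpha A B x ->
  ex_finite_lim_seq (fun n : nat => x (4 * Z.of_nat n + i)%Z).
Proof.
  intros Halpha HB Hq Hi Hx Hwd Hrec.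
  (* The products inverted by [w (2 * m)] and [w (S (2 * m))] share their middle factor, which
     cancels in the quotient. *)
  set (w := fun k : nat =>
    / (x (i + 2 * Z.of_nat k)%Z * x (i + 2 * Z.of_nat k + 2)%Z)).
  apply (ex_finite_lim_product _ (fun m => w (2 * m)%nat / w (S (2 * m)) - 1)).
  - intros m; unfold w.
    replace (i + 2 * Z.of_nat (2 * m))%Z with (4 * Z.of_nat m + i)%Z by lia.
    replace (i + 2 * Z.of_nat (S (2 * m)))%Z with (4 * Z.of_nat m + i + 2)%Z by lia.
    replace (4 * Z.of_nat m + i + 2 + 2)%Z with (4 * Z.of_nat (S m) + i)%Z by lia.
    field; repeat split; apply Hx; lia.
  - apply (affine_quotients_summable (A / alpha) (B / alpha)); auto.
    + apply Rmult_integral_contrapositive_currified; auto using Rinv_neq_0_compat.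
    + intros k; unfold w.
      (* With this shift [w k] inverts [x (n - 3) * x (n - 1)] and [w (S k)] inverts
         [x (n - 1) * x (n + 1)], so the recurrence at [n] links them; [-3 <= i] is exactly what
         gives [0 <= n] for every [k]. *)
      set (n := (i + 2 * Z.of_nat k + 3)%Z).
      assert (Hn : (0 <= n)%Z) by (unfold n; lia).
      replace (i + 2 * Z.of_nat (S k))%Z with (n - 1)%Z by (unfold n; lia).
      replace (n - 1 + 2)%Z with (n + 1)%Z by ring.
      replace (i + 2 * Z.of_nat k)%Z with (n - 3)%Z by (unfold n; lia).
      replace (n - 3 + 2)%Z with (n - 1)%Z by ring.
      rewrite (Hrec n Hn).
      pose proof (Hwd n Hn).
      assert (x (n - 3)%Z <> 0) by (apply Hx; lia).
      assert (x (n - 1)%Z <> 0) by (apply Hx; lia).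
      field; repeat split; auto.
    + intros k; apply Rinv_neq_0_compat, Rmult_integral_contrapositive_currified;
        apply Hx; lia.
Qed.

Theorem theorem3p4 :
  forall (alpha A B : R),
    alpha <> 0 -> B <> 0 -> Rabs (A / alpha) < 1 ->
  forall (a b c d : R),
    a <> 0 -> b <> 0 -> c <> 0 -> d <> 0 ->
  forall (x : Z -> R),
    is_solution alpha A B a b c d x ->
    ex_finite_lim_seq (fun n : nat => x (4 * Z.of_nat n - 3)%Z) /\
    ex_finite_lim_seq (fun n : nat => x (4 * Z.of_nat n - 2)%Z) /\
    ex_finite_lim_seq (fun n : nat => x (4 * Z.of_nat n - 1)%Z) /\
    ex_finite_lim_seq (fun n : nat => x (4 * Z.of_nat n)%Z).
Proof.
  intros alpha A B Halpha HB Hq a b c d Ha Hb Hc Hd x Hsol.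
  pose proof (solution_neq_0 alpha A B a b c d x Halpha Ha Hb Hc Hd Hsol) as Hx.
  destruct Hsol as [_ [Hwd Hrec]].
  assert (H : forall i, (-3 <= i)%Z ->
    ex_finite_lim_seq (fun n : nat => x (4 * Z.of_nat n + i)%Z))
    by (intros i Hi; apply (step_4_subsequence_converges alpha A B); auto).
  split; [|split; [|split]].
  - apply (H (-3)%Z); lia.
  - apply (H (-2)%Z); lia.
  - apply (H (-1)%Z); lia.
  (* Unlike the other three offsets, [+ 0] does not disappear by conversion, so the sequence is
     rewritten pointwise. *)
  - destruct (H 0%Z) as [l Hl]; [lia|]; exists l.
    apply is_lim_seq_ext with (2 := Hl).
    intros n; f_equal; ring.
Qed.
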